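(* There is a linear-size translation from $\mathrm{FO}_{=}$ formulas into CoR equations preserving validity and finite validity; that is, a computable map $f$ sending each $\mathrm{FO}_{=}$ formula $\varphi$ to a CoR equation $f(\varphi)$ such that $\|f(\varphi)\|$ is bounded by a linear function of $\|\varphi\|$, $\varphi$ is valid if and only if $f(\varphi)$ is valid, and $\varphi$ is finitely valid if and only if $f(\varphi)$ is finitely valid.
   Context: Fix a countably infinite set $\Sigma$ of binary predicate symbols and a countably infinite set $\mathbf{V}$ of variables. A structure $\mathfrak{A}$ over a set $A$ of symbols consists of a non-empty set $|\mathfrak{A}|$ and a binary relation $a^{\mathfrak{A}}\subseteq|\mathfrak{A}|^2$ for each $a\in A$; it is finite if $|\mathfrak{A}|$ is finite. $\mathrm{FO}_{=}$ formulas are given by $\varphi::= a(x,y)\mid x=y\mid \lnot\varphi\mid \varphi\land\psi\mid \exists x,\varphi$ with $a\in\Sigma$, $x,y\in\mathbf{V}$, with the usual Tarskian semantics over structures over $\Sigma$ (under assignments $\mathbf{V}\to|\mathfrak{A}|$). A formula is valid (resp. finitely valid) if it is satisfied by every assignment in every structure (resp. every finite structure) over $\Sigma$. Size: $\|a(x,y)\|=\|x=y\|=3$, $\|\lnot\varphi\|=1+\|\varphi\|$, $\|\varphi\land\psi\|=1+\|\varphi\|+\|\psi\|$, $\|\exists x,\varphi\|=2+\|\varphi\|$. CoR (calculus of relations) terms over $\Sigma$ (elements of $\Sigma$ serve as term variables) are given by $t::=a\mid \mathsf{I}\mid t^{-}\mid t\cap s\mid t\cdot s\mid t^{\smile}$,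 interpreted in a structure $\mathfrak{A}$ over $\Sigma$ as binary relations on $|\mathfrak{A}|$: $a$ as $a^{\mathfrak{A}}$, $\mathsf{I}$ as the identity relation, $^{-}$ as complement relative to $|\mathfrak{A}|^2$, $\cap$ as intersection, $\cdot$ as relational composition, $^{\smile}$ as converse. Size: $\|a\|=\|\mathsf{I}\|=1$, each unary operator adds $1$, each binary operator gives $1$ plus the sizes of its arguments. A CoR equation $t=s$ holds in $\mathfrak{A}$ if $t$ and $s$ denote the same relation; it is valid (resp. finitely valid) if it holds in every structure (resp. every finite structure) over $\Sigma$; $\|t=s\|=1+\|t\|+\|s\|$. *)

(* Defs.v *)
From Stdlib Require Import List Arith Relations FinFun.
Import ListNotations.

(** The countably infinite alphabets [Sigma] and [V] are both taken to be
    [nat], so that computability of the translation makes sense. *)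

Definition symbol := nat.
Definition variable := nat.

Record structure := Structure {
  carrier :> Type;
  carrier_inhabited : inhabited carrier;
  interp : symbol -> relation carrier
}.

Inductive formula :=
| Rel (a : symbol) (x y : variable)
| Eq (x y : variable)
| Not (phi : formula)
| And (phi psi : formula)
| Ex (x : variable) (phi : formula).

Fixpoint formula_size (phi : formula) : nat :=
  match phi with
  | Rel _ _ _ | Eq _ _ => 3
  | Not phi => 1 + formula_size phi
  | And phi psi => 1 + formula_size phi + formula_size psi
  | Ex _ phi => 2 + formula_size phi
  end.

Definition update {A : Type} (v : variable -> A) (x : variable) (d : A) :
    variable -> A :=
  fun y => if Nat.eqb y x then d else v y.

Fixpoint satisfies (M : structure) (v : variable -> M) (phi : formula) : Prop :=
  match phi with
  | Rel a x y => interp M a (v x) (v y)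
  | Eq x y => v x = v y
  | Not phi => ~ satisfies M v phi
  | And phi psi => satisfies M v phi /\ satisfies M v psi
  | Ex x phi => exists d : M, satisfies M (update v x d) phi
  end.

Definition formula_valid (phi : formula) : Prop :=
  forall (M : structure) (v : variable -> M), satisfies M v phi.

Definition formula_finitely_valid (phi : formula) : Prop :=
  forall M : structure, Finite M ->
  forall v : variable -> M, satisfies M v phi.

Inductive cor_term :=
| Sym (a : symbol)
| Id
| Compl (t : cor_term)
| Inter (t s : cor_term)
| Comp (t s : cor_term)
| Conv (t : cor_term).

Record cor_equation := CorEq { lhs : cor_term; rhs : cor_term }.

Fixpoint cor_term_size (t : cor_term) : nat :=
  match t with
  | Sym _ | Id => 1
  | Compl t | Conv t => 1 + cor_term_size t
  | Inter t s | Comp t s => 1 + cor_term_size t + cor_term_size s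
  end.

Definition cor_equation_size (e : cor_equation) : nat :=
  1 + cor_term_size (lhs e) + cor_term_size (rhs e).

Fixpoint denote (M : structure) (t : cor_term) : relation M :=
  match t with
  | Sym a => interp M a
  | Id => fun x y => x = y
  | Compl t => fun x y => ~ denote M t x y
  | Inter t s => fun x y => denote M t x y /\ denote M s x y
  | Comp t s => fun x y => exists z : M, denote M t x z /\ denote M s z y
  | Conv t => fun x y => denote M t y x
  end.

Definition holds (M : structure) (e : cor_equation) : Prop :=
  forall x y : M, denote M (lhs e) x y <-> denote M (rhs e) x y.

Definition equation_valid (e : cor_equation) : Prop :=
  forall M : structure, holds M e.

Definition equation_finitely_valid (e : cor_equation) : Prop :=
  forall M : structure, Finite M -> holds M e.

(** Computability is lambda-definability in the weak call-by-value
    lambda-calculus with de Bruijn indices and Scott-encoded data: the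
    Turing-complete calculus L (Forster and Smolka, Weak Call-by-Value Lambda
    Calculus as a Model of Computation in Coq, ITP 2017). *)

Inductive lterm :=
| LVar (n : nat)
| LApp (s t : lterm)
| LLam (s : lterm).

(** No index shifting under binders: substitution is only meant for a closed
    [u], and reducing a closed term never substitutes an open one. *)
Fixpoint lsubst (s : lterm) (k : nat) (u : lterm) : lterm :=
  match s with
  | LVar n => if Nat.eqb n k then u else LVar n
  | LApp s t => LApp (lsubst s k u) (lsubst t k u)
  | LLam s => LLam (lsubst s (S k) u)
  end.

Fixpoint lbounded (k : nat) (s : lterm) : Prop :=
  match s with
  | LVar n => n < k
  | LApp s t => lbounded k s /\ lbounded k t
  | LLam s => lbounded (S k) s
  end.

Definition lclosed (s : lterm) : Prop := lbounded 0 s.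

Inductive lstep : relation lterm :=
| lstep_beta s t : lstep (LApp (LLam s) (LLam t)) (lsubst s 0 (LLam t))
| lstep_appl s s' t : lstep s s' -> lstep (LApp s t) (LApp s' t)
| lstep_appr s t t' : lstep t t' -> lstep (LApp s t) (LApp s t').

Definition lsteps : relation lterm := clos_refl_trans lterm lstep.

(** Scott encoding of the [i]-th (from 0) of [k] constructors applied to
    arguments with encodings [args]: [fun c_0 ... c_(k-1) => c_i args]. *)
Definition scott (k i : nat) (args : list lterm) : lterm :=
  Nat.iter k LLam (fold_left LApp args (LVar (k - 1 - i))).

Fixpoint encode_nat (n : nat) : lterm :=
  match n with
  | 0 => scott 2 0 []
  | S n => scott 2 1 [encode_nat n]
  end.

Fixpoint encode_formula (phi : formula) : lterm :=
  match phi with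
  | Rel a x y => scott 5 0 [encode_nat a; encode_nat x; encode_nat y]
  | Eq x y => scott 5 1 [encode_nat x; encode_nat y]
  | Not phi => scott 5 2 [encode_formula phi]
  | And phi psi => scott 5 3 [encode_formula phi; encode_formula psi]
  | Ex x phi => scott 5 4 [encode_nat x; encode_formula phi]
  end.

Fixpoint encode_cor_term (t : cor_term) : lterm :=
  match t with
  | Sym a => scott 6 0 [encode_nat a]
  | Id => scott 6 1 []
  | Compl t => scott 6 2 [encode_cor_term t]
  | Inter t s => scott 6 3 [encode_cor_term t; encode_cor_term s]
  | Comp t s => scott 6 4 [encode_cor_term t; encode_cor_term s]
  | Conv t => scott 6 5 [encode_cor_term t]
  end.

Definition encode_cor_equation (e : cor_equation) : lterm :=
  scott 1 0 [encode_cor_term (lhs e); encode_cor_term (rhs e)].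

(** Encodings are abstractions, hence normal forms; reduction being confluent,
    the output encoding is uniquely determined by the input encoding. *)
Definition computable (f : formula -> cor_equation) : Prop :=
  exists p : lterm, lclosed p /\
    forall phi : formula,
      lsteps (LApp p (encode_formula phi)) (encode_cor_equation (f phi)).

(* Main.v *)
(** The equation of [phi] is interpreted in structures whose elements are
    assignments. A symbol [value x] maps an assignment to (a code of) the value
    of [x], so that atomic formulas become tests on an assignment and [Ex x]
    becomes composition with the relation "agree on all variables except [x]".
    Writing that relation as an intersection over all other variables would
    make the translation quadratic. Instead, the variables of [phi] are sorted,
    symbols [below x] and [above x] stand for agreement on all smaller, resp.
    larger, variables, and two axioms for each pair of consecutive variables
    relate these symbols. The equation says that, if the axioms hold, then the
    term translating [phi] is full. A model [M] of the negation of [phi] yields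
    the structure of assignments over [M] of finitely many variables, which is
    finite if [M] is; conversely the base elements of a structure satisfying
    the axioms form a model on which the term and [phi] agree. *)

From Stdlib Require Import List Arith Lia Relations FinFun Sorted Classical ClassicalEpsilon ProofIrrelevance.
Import ListNotations.
Require Import Defs.

(** * The translation and its axioms *)

Definition empty : cor_term := Inter Id (Compl Id).
Definition top : cor_term := Compl empty.
Definition included (t s : cor_term) : cor_term := Compl (Inter t (Compl s)).

(** The four families of symbols occupy distinct residues modulo 4, so they share one alphabet
    without clashing. *)
Definition value (x : variable) : cor_term := Sym (4 * x).
Definition below (x : variable) : cor_term := Sym (1 + 4 * x).
Definition above (x : variable) : cor_term := Sym (2 + 4 * x).
Definition atom (a : symbol) : cor_term := Sym (3 + 4 * a).

Definition same (x : variable) : cor_term := Comp (value x) (Conv (value x)).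
Definition others (x : variable) : cor_term := Inter (below x) (above x).
(** Composing with [top] forgets the second argument, leaving the set of points at which [t] is
    reflexive. Complement, intersection and composition on the left keep this form, so every
    translated formula denotes a set of assignments. *)
Definition test (t : cor_term) : cor_term := Comp (Inter t Id) top.

Fixpoint translate (phi : formula) : cor_term :=
  match phi with
  | Rel a x y => test (Comp (value x) (Comp (atom a) (Conv (value y))))
  | Eq x y => test (Comp (value x) (Conv (value y)))
  | Not phi => Compl (translate phi)
  | And phi psi => Inter (translate phi) (translate psi)
  | Ex x phi => Comp (others x) (translate phi)
  end.

(* Base elements are the possible values of variable 0. *)
Definition base : cor_term := Comp top (value 0).

(** In order: [value x] is total, is functional, takes base elements as values, and can be changed
    to any base element by a move along [others x]. *)
Definition local_axioms (x : variable) : cor_term :=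
  Inter (Inter (included Id (same x)) (included (Comp (Conv (value x)) (value x)) Id))
        (Inter (included (value x) base) (included base (Comp (others x) (value x)))).

(** Meant for [x] before [y]. The size is constant, so imposing this only on neighbours in the
    sorted list keeps the axioms linear. *)
Definition order_axioms (x y : variable) : cor_term :=
  Inter (included (below y) (Inter (below x) (same x)))
        (included (above x) (Inter (above y) (same y))).

Definition head_axioms (x : variable) (l : list variable) : cor_term :=
  match l with
  | [] => top
  | y :: _ => order_axioms x y
  end.

Fixpoint axioms (l : list variable) : cor_term :=
  match l with
  | [] => top
  | x :: l => Inter (Inter (local_axioms x) (head_axioms x l)) (axioms l)
  end.

Fixpoint insert (x : variable) (l : list variable) : list variable :=
  match l with
  | [] => [x]
  | y :: l' =>
      match Nat.compare x y with
      | Datatypes.Eq => l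
      | Lt => x :: l
      | Gt => y :: insert x l'
      end
  end.

Fixpoint add_vars (phi : formula) (l : list variable) : list variable :=
  match phi with
  | Rel _ x y | Eq x y => insert x (insert y l)
  | Not phi => add_vars phi l
  | And phi psi => add_vars phi (add_vars psi l)
  | Ex x phi => insert x (add_vars phi l)
  end.

(** Variable 0 is always included because [base] is defined through it. *)
Definition vars (phi : formula) : list variable := add_vars phi [0].

(** Composition with [top] on both sides makes any non-empty relation full. The first component of
    the intersection is therefore full if the axioms are full and empty otherwise, which lets one
    equation express an implication. *)
Definition equation (phi : formula) : cor_equation :=
  CorEq (Inter (Compl (Comp top (Comp (Compl (axioms (vars phi))) top)))
               (Compl (translate phi)))
        empty.

(** * Collecting variables *)

Lemma in_insert x y l : In y (insert x l) <-> y = x \/ In y l.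
Proof.
  induction l as [|z l IH]; simpl.
  - intuition.
  - destruct (Nat.compare_spec x z); simpl; rewrite ?IH; subst; intuition.
Qed.

Lemma hdrel_insert x y l : y < x -> HdRel lt y l -> HdRel lt y (insert x l).
Proof.
  destruct l as [|z l]; simpl; intros Hx Hl; [auto|].
  inversion Hl; destruct (Nat.compare_spec x z); auto.
Qed.

Lemma sorted_insert x l : Sorted lt l -> Sorted lt (insert x l).
Proof.
  induction 1 as [|y l Hl IH Hd]; simpl; [auto|].
  destruct (Nat.compare_spec x y); auto using hdrel_insert.
Qed.

Lemma length_insert x l : length (insert x l) <= S (length l).
Proof.
  induction l as [|y l IH]; simpl; [lia|].
  destruct (Nat.compare x y); simpl; lia.
Qed.

Lemma sorted_add_vars phi l : Sorted lt l -> Sorted lt (add_vars phi l).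
Proof. revert l; induction phi; simpl; auto using sorted_insert. Qed.

(** Each node of the formula inserts fewer variables than it contributes to the size. *)
Lemma length_add_vars phi l :
  length (add_vars phi l) <= formula_size phi + length l.
Proof.
  revert l; induction phi as [a x y|x y|phi IH|phi IH1 psi IH2|x phi IH];
    intros l; simpl.
  - pose proof (length_insert x (insert y l)); pose proof (length_insert y l); lia.
  - pose proof (length_insert x (insert y l)); pose proof (length_insert y l); lia.
  - specialize (IH l); lia.
  - specialize (IH1 (add_vars psi l)); specialize (IH2 l); lia.
  - pose proof (length_insert x (add_vars phi l)); specialize (IH l); lia.
Qed.

Lemma add_vars_incl phi l : incl l (add_vars phi l).
Proof.
  unfold incl; revert l; induction phi; intros l z Hz; simpl;
    rewrite ?in_insert; auto.
Qed.

Lemma sorted_vars phi : Sorted lt (vars phi).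
Proof. apply sorted_add_vars; auto. Qed.

(** Bound variables count as well, since the translation of [Ex x] relies on the axioms for [x]. *)
Fixpoint var_in (l : list variable) (phi : formula) : Prop :=
  match phi with
  | Rel _ x y | Eq x y => In x l /\ In y l
  | Not phi => var_in l phi
  | And phi psi => var_in l phi /\ var_in l psi
  | Ex x phi => In x l /\ var_in l phi
  end.

Lemma var_in_incl l l' phi : incl l l' -> var_in l phi -> var_in l' phi.
Proof. intros Hl; induction phi; simpl; intuition. Qed.

Lemma var_in_add_vars phi l : var_in (add_vars phi l) phi.
Proof.
  revert l; induction phi; intros l; simpl; rewrite ?in_insert; auto.
  - split; auto. apply (var_in_incl (add_vars phi2 l)); auto using add_vars_incl.
  - split; auto. apply (var_in_incl (add_vars phi l)); auto.
    intros z Hz; apply in_insert; auto.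
Qed.

(** * Linear size bounds *)

Lemma axioms_size l : cor_term_size (axioms l) <= 100 * length l + 5.
Proof. induction l as [|x [|y l] IH]; simpl in *; lia. Qed.

Lemma translate_size phi : cor_term_size (translate phi) <= 5 * formula_size phi.
Proof. induction phi; simpl; lia. Qed.

(** The slope 105 adds 100 for the axioms, through the number of variables, to 5 for the translated
    formula; 200 absorbs the extra variable 0 and the outer operators. *)
Lemma equation_size phi :
  cor_equation_size (equation phi) <= 105 * formula_size phi + 200.
Proof.
  pose proof (axioms_size (vars phi)).
  pose proof (translate_size phi).
  pose proof (length_add_vars phi [0]).
  unfold cor_equation_size; simpl; unfold vars in *; simpl in *; lia.
Qed.

(** * Models of the axioms *)

Definition full (C : structure) (t : cor_term) : Prop :=
  forall u w : C, denote C t u w.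

Lemma full_top C : full C top.
Proof. intros u w; simpl; tauto. Qed.

Lemma full_inter C t s : full C (Inter t s) <-> full C t /\ full C s.
Proof. unfold full; simpl; firstorder. Qed.

Lemma full_included C t s :
  full C (included t s) <-> forall u w, denote C t u w -> denote C s u w.
Proof.
  unfold full; simpl; split; intros H u w.
  - intros Ht; apply NNPP; intros Hs; apply (H u w); auto.
  - intros [Ht Hs]; auto.
Qed.

(** Stating the axioms on neighbours as sortedness makes the passage from neighbours to arbitrary
    pairs an instance of [Sorted_StronglySorted]. *)
Lemma full_axioms C l :
  full C (axioms l) <->
  (forall x, In x l -> full C (local_axioms x)) /\
  Sorted (fun x y => full C (order_axioms x y)) l.
Proof.
  induction l as [|x l IH].
  - split; [|intros _; apply full_top]. simpl; intuition.
  - simpl axioms. rewrite !full_inter, IH.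
    assert (full C (head_axioms x l) <->
            HdRel (fun x y => full C (order_axioms x y)) x l) as ->.
    { destruct l; simpl; split; auto using full_top.
      intros H; inversion H; auto. }
    split.
    + intros [[? ?] [? ?]]; split; auto. intros y [<-|]; auto.
    + intros [H1 H2]; inversion H2; subst; simpl in H1; auto 6.
Qed.

Lemma holds_equation C phi :
  holds C (equation phi) <->
  (full C (axioms (vars phi)) -> full C (translate phi)).
Proof.
  unfold holds, full; simpl; split.
  - intros H Ha u w; apply NNPP; intros Ht.
    destruct (H u w) as [H' _].
    destruct H' as [? ?]; auto. split; auto.
    intros (z & _ & z' & Hz & _); auto.
  - intros H u w; split; [|tauto].
    intros [Ha Ht]; exfalso; apply Ht, H.
    intros u' w'; apply NNPP; intros Hn; apply Ha.
    exists u'; split; [tauto|]. exists w'; tauto.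
Qed.

Lemma order_axioms_trans C x y z :
  full C (order_axioms x y) -> full C (order_axioms y z) ->
  full C (order_axioms x z).
Proof.
  unfold order_axioms; rewrite !full_inter, !full_included; simpl.
  intros [H1 H2] [H3 H4]; split; intros u w Hu.
  - apply H1, H3, Hu.
  - apply H4, H2, Hu.
Qed.

(** By transitivity the order axioms hold between any two listed variables, in list order. If [y]
    comes after [x], agreement on [y] follows from [above x]; if before, from [below x]. *)
Lemma others_same C l x y u w :
  full C (axioms l) -> In x l -> In y l -> x <> y ->
  denote C (others x) u w -> denote C (same y) u w.
Proof.
  intros [_ Hs]%full_axioms Hx Hy Hne [Hb Ha].
  apply Sorted_StronglySorted in Hs; [|exact (order_axioms_trans C)].
  assert (full C (order_axioms x y) \/ full C (order_axioms y x)) as [H|H].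
  { clear Hb Ha. induction Hs as [|z l Hs IH Hall]; [easy|].
    rewrite Forall_forall in Hall.
    destruct Hx as [<-|Hx], Hy as [<-|Hy]; auto; easy. }
  all: unfold order_axioms in H; rewrite full_inter, !full_included in H.
  - apply (proj2 H _ _ Ha).
  - apply (proj1 H _ _ Hb).
Qed.

(* [M] is, up to the embedding [b], the set of base elements of [C]. *)
Record base_model (C M : structure) (b : M -> C) : Prop := {
  base_inj : forall d e, b d = b e -> d = e;
  base_range : forall c, (exists d, c = b d) <-> exists u, denote C (value 0) u c;
  base_atom : forall a d e, denote C (atom a) (b d) (b e) <-> interp M a d e
}.

(** Truth lemma: the point [u] stands for any assignment [v] whose values on [l] it codes through
    [b]. Both vary in the induction because a quantifier moves [u] and updates [v]. *)
Lemma translate_correct C M b l phi u w v :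
  base_model C M b -> full C (axioms l) -> var_in l phi ->
  (forall x, In x l -> denote C (value x) u (b (v x))) ->
  denote C (translate phi) u w <-> satisfies M v phi.
Proof.
  intros [Hinj Hrange Hatom] Hax.
  pose proof (proj1 (proj1 (full_axioms C l) Hax)) as Hloc.
  assert (Hfun : forall x u c c', In x l -> denote C (value x) u c ->
            denote C (value x) u c' -> c = c').
  { intros x u' c c' Hx Hc Hc'. specialize (Hloc x Hx).
    unfold local_axioms in Hloc; rewrite !full_inter, !full_included in Hloc.
    destruct Hloc as [[_ H] _]; apply H; exists u'; auto. }
  revert u w v.
  induction phi as [a x y|x y|phi IH|phi IH1 psi IH2|x phi IH];
    intros u w v Hvars Hv; simpl in Hvars |- *.
  - destruct Hvars as [Hx Hy]; rewrite <- Hatom; split.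
    + intros (z & ((c & Hc & e & Ha & He) & <-) & _).
      rewrite (Hfun x u (b (v x)) c), (Hfun y u (b (v y)) e); auto.
    + intros H. exists u; split; [split; auto|tauto].
      exists (b (v x)); split; [apply Hv; auto|].
      exists (b (v y)); split; [auto|apply Hv; auto].
  - destruct Hvars as [Hx Hy]; split.
    + intros (z & ((c & Hc & He) & <-) & _).
      apply Hinj; rewrite (Hfun x u (b (v x)) c), (Hfun y u (b (v y)) c); auto.
    + intros H. exists u; split; [split; auto|tauto].
      exists (b (v x)); split; [apply Hv; auto|rewrite H; apply Hv; auto].
  - rewrite IH; eauto; tauto.
  - rewrite IH1, IH2; intuition eauto.
  - destruct Hvars as [Hx Hphi].
    (* A move along [others x] realises an update: at [y] other than [x] both points share a value,
       which functionality identifies with the old one. *)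
    assert (Hstep : forall u' d, denote C (others x) u u' ->
              denote C (value x) u' (b d) ->
              forall y, In y l -> denote C (value y) u' (b (update v x d y))).
    { intros u' d Ho Hd y Hy. unfold update.
      destruct (Nat.eqb_spec y x) as [->|Hne]; auto.
      destruct (others_same C l x y u u') as (c & Hc & Hc'); auto.
      rewrite (Hfun y u (b (v y)) c); auto. }
    specialize (Hloc x Hx).
    unfold local_axioms in Hloc; rewrite !full_inter, !full_included in Hloc.
    destruct Hloc as [[Htot _] [Hran Hmove]].
    split.
    + intros (u' & Ho & Ht).
      (* The witness for the quantifier is the value of [x] at the point reached; it is a base
         element, hence of the form [b d]. *)
      destruct (Htot u' u' eq_refl) as (c & Hc & _).
      destruct (Hran u' c Hc) as (z & _ & Hz).
      destruct (proj2 (Hrange c)) as [d ->]; eauto.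
      exists d; apply (IH u' w); auto.
    + intros [d Hd].
      destruct (proj1 (Hrange (b d))) as [z Hz]; eauto.
      (* Conversely, the last local axiom supplies a point carrying the chosen value [b d] at
         [x]. *)
      destruct (Hmove u (b d)) as (u' & Ho & Hu').
      { exists z; split; auto. apply full_top. }
      exists u'; split; auto. apply (IH u' w _ Hphi (Hstep u' d Ho Hu')), Hd.
Qed.

(** * The base of a model *)

Lemma zero_in_vars phi : In 0 (vars phi).
Proof. apply add_vars_incl; simpl; auto. Qed.

(** Excluded middle filters the enumeration of [A], and proof irrelevance makes the attached proofs
    immaterial. *)
Lemma finite_sig (A : Type) (P : A -> Prop) : Finite A -> Finite {x | P x}.
Proof.
  intros [l Hl].
  assert (exists l' : list {x | P x}, forall a, In (proj1_sig a) l -> In a l')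
    as [l' Hl'].
  { clear Hl. induction l as [|x l [l' IH]].
    - exists []; simpl; tauto.
    - destruct (classic (P x)) as [Hx|Hx].
      + exists (exist _ x Hx :: l'). intros [y Hy]; simpl; intros [<-|H]; auto.
        left; f_equal; apply proof_irrelevance.
      + exists l'. intros [y Hy]; simpl; intros [<-|H]; [easy|auto]. }
  exists l'; intros a; auto.
Qed.

(** The model is the subset of base elements, hence finite when [C] is, and [v] reads off the values
    of the variables at [u]. *)
Lemma base_model_exists (C : structure) phi (u : C) :
  full C (axioms (vars phi)) ->
  exists (M : structure) (b : M -> C) (v : variable -> M),
    (Finite C -> Finite M) /\ base_model C M b /\
    forall x, In x (vars phi) -> denote C (value x) u (b (v x)).
Proof.
  intros Hax; pose proof (proj1 (proj1 (full_axioms C _) Hax)) as Hloc.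
  set (P := fun c : C => exists u, denote C (value 0) u c).
  (* Membership in [vars phi] is placed under the existential so that choice yields a total
     assignment; an unlisted variable receives the value of variable 0 as a default. *)
  assert (Hval : forall x, exists c : {c | P c},
            In x (vars phi) -> denote C (value x) u (proj1_sig c)).
  { assert (H : forall x, In x (vars phi) -> exists c : {c | P c},
              denote C (value x) u (proj1_sig c)).
    { intros x Hx; specialize (Hloc x Hx).
      unfold local_axioms in Hloc; rewrite !full_inter, !full_included in Hloc.
      destruct Hloc as [[Htot _] [Hran _]].
      destruct (Htot u u eq_refl) as (c & Hc & _).
      destruct (Hran u c Hc) as (z & _ & Hz).
      exists (exist _ c (ex_intro _ z Hz)); auto. }
    intros x; destruct (classic (In x (vars phi))) as [Hx|Hx].
    - destruct (H x Hx) as [c Hc]; exists c; auto.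
    - destruct (H 0 (zero_in_vars phi)) as [c _]; exists c; easy. }
  set (M := Structure {c | P c}
     (match Hval 0 with ex_intro _ c _ => inhabits c end)
     (fun a c d => denote C (atom a) (proj1_sig c) (proj1_sig d))).
  set (v := fun x => proj1_sig (constructive_indefinite_description _ (Hval x))).
  exists M, (@proj1_sig _ P), v; repeat split.
  - apply finite_sig.
  - intros [d Hd] [e He]; simpl; intros <-; f_equal; apply proof_irrelevance.
  - intros [[d Hd] ->]; auto.
  - intros Hc; exists (exist _ c Hc); auto.
  - auto.
  - auto.
  - intros x; exact (proj2_sig (constructive_indefinite_description _ (Hval x))).
Qed.

(** * The model of assignments *)

Section Assignments.
Variable M : structure.
Variable m : M.

(** Nested pairs give finiteness by products, and equality of tuples without functional
    extensionality. *)
Fixpoint tuple (n : nat) : Type :=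
  match n with
  | 0 => unit
  | S n => M * tuple n
  end.

Fixpoint of_fun (n : nat) (v : variable -> M) : tuple n :=
  match n with
  | 0 => tt
  | S n => (v 0, of_fun n (fun x => v (S x)))
  end.

Fixpoint get (n : nat) : tuple n -> variable -> M :=
  match n with
  | 0 => fun _ _ => m
  | S n => fun t x => match x with 0 => fst t | S x => get n (snd t) x end
  end.

Lemma get_of_fun n v x : x < n -> get n (of_fun n v) x = v x.
Proof.
  revert v x; induction n as [|n IH]; intros v x Hx; [lia|].
  destruct x as [|x]; simpl; [|rewrite IH]; auto; lia.
Qed.

Lemma finite_tuple n : Finite M -> Finite (tuple n).
Proof.
  intros [l Hl]; induction n as [|n [l' IH]]; simpl.
  - exists [tt]; intros []; simpl; auto.
  - exists (list_prod l l'); intros [d t]; apply in_prod; auto.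
Qed.

(** Constant tuples code the elements of [M], so that values and assignments live in one carrier. *)
Definition const (n : nat) (d : M) : tuple n := of_fun n (fun _ => d).

(** The residue of a symbol modulo 4 recovers its family and the quotient its index; the last branch
    is residue 3, the atoms. *)
Definition assignments (n : nat) : structure :=
  Structure (tuple n) (inhabits (const n m))
    (fun k s t =>
       match k mod 4 with
       | 0 => t = const n (get n s (k / 4))
       | 1 => forall y, y < n -> y < k / 4 -> get n s y = get n t y
       | 2 => forall y, y < n -> k / 4 < y -> get n s y = get n t y
       | _ => exists d e, s = const n d /\ t = const n e /\ interp M (k / 4) d e
       end).

Lemma interp_assignments n i x :
  i < 4 ->
  interp (assignments n) (i + 4 * x) =
    (fun s t =>
       match i with
       | 0 => t = const n (get n s x)
       | 1 => forall y, y < n -> y < x -> get n s y = get n t y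
       | 2 => forall y, y < n -> x < y -> get n s y = get n t y
       | _ => exists d e, s = const n d /\ t = const n e /\ interp M x d e
       end).
Proof.
  intros Hi; cbn [interp assignments].
  rewrite <- (Nat.mod_unique (i + 4 * x) 4 x i),
    <- (Nat.div_unique (i + 4 * x) 4 x i); auto; lia.
Qed.

Lemma assignments_value n x s t :
  denote (assignments n) (value x) s t <-> t = const n (get n s x).
Proof.
  change (value x) with (Sym (0 + 4 * x)); cbn [denote].
  rewrite interp_assignments by lia; reflexivity.
Qed.

Lemma assignments_below n x s t :
  denote (assignments n) (below x) s t <->
  forall y, y < n -> y < x -> get n s y = get n t y.
Proof.
  unfold below; cbn [denote].
  rewrite interp_assignments by lia; reflexivity.
Qed.

Lemma assignments_above n x s t :
  denote (assignments n) (above x) s t <->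
  forall y, y < n -> x < y -> get n s y = get n t y.
Proof.
  unfold above; cbn [denote].
  rewrite interp_assignments by lia; reflexivity.
Qed.

Lemma assignments_atom n a s t :
  denote (assignments n) (atom a) s t <->
  exists d e, s = const n d /\ t = const n e /\ interp M a d e.
Proof.
  unfold atom; cbn [denote].
  rewrite interp_assignments by lia; reflexivity.
Qed.

Lemma assignments_same n x s t :
  get n s x = get n t x -> denote (assignments n) (same x) s t.
Proof.
  intros H; exists (const n (get n s x)); cbn [denote]; split.
  - apply assignments_value; reflexivity.
  - apply assignments_value; rewrite H; reflexivity.
Qed.

(** With [n = 0] all elements would share the single empty tuple as code. *)
Lemma const_inj n d e : 0 < n -> const n d = const n e -> d = e.
Proof. destruct n; [lia|]; intros _ [= H _]; auto. Qed.

Lemma assignments_base n u d : 0 < n -> denote (assignments n) base u (const n d).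
Proof.
  intros Hn; exists (const n d); split; [apply full_top|].
  apply assignments_value; unfold const; rewrite get_of_fun; auto.
Qed.

Lemma base_model_assignments n :
  0 < n -> base_model (assignments n) M (const n).
Proof.
  intros Hn; split.
  - intros d e; apply const_inj, Hn.
  - intros c; split.
    + intros [d ->]. destruct (assignments_base n (const n d) d Hn) as (z & _ & Hz); eauto.
    + intros [u Hu]; rewrite assignments_value in Hu; eauto.
  - intros a d e; rewrite assignments_atom; split; [|eauto].
    intros (d' & e' & Hd & He & H).
    apply const_inj in Hd, He; subst; auto.
Qed.

Lemma axioms_assignments n l :
  0 < n -> (forall x, In x l -> x < n) -> Sorted lt l ->
  full (assignments n) (axioms l).
Proof.
  intros Hn Hl Hs; apply full_axioms; split.
  - intros x Hx; specialize (Hl x Hx).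
    unfold local_axioms; rewrite !full_inter, !full_included; repeat split.
    + intros u w Huw; apply assignments_same; simpl in Huw; subst; auto.
    + intros u w (z & Hu & Hw); cbn [denote] in Hu.
      rewrite assignments_value in Hu, Hw; simpl; congruence.
    + intros u w H; rewrite assignments_value in H; subst w.
      apply assignments_base, Hn.
    + intros u w (z & _ & H); rewrite assignments_value in H; subst w.
      (* The given base element codes [d]; overwriting position [x] of [u] with [d] gives the
         required assignment. *)
      set (d := get n z 0).
      exists (of_fun n (update (get n u) x d)); repeat split.
      * apply assignments_below; intros y Hy Hyx; rewrite get_of_fun by auto.
        unfold update; destruct (Nat.eqb_spec y x); auto; lia.
      * apply assignments_above; intros y Hy Hyx; rewrite get_of_fun by auto.
        unfold update; destruct (Nat.eqb_spec y x); auto; lia.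
      * apply assignments_value; rewrite get_of_fun by auto.
        unfold update; rewrite Nat.eqb_refl; auto.
  (* The order axioms hold for all increasing pairs, in particular for neighbours in the sorted
     list. *)
  - assert (Hord : forall x y, In x l -> In y l -> x < y ->
              full (assignments n) (order_axioms x y)).
    { intros x y Hx Hy Hxy. apply Hl in Hx, Hy.
      unfold order_axioms; rewrite full_inter, !full_included.
      split; intros u w H.
      - rewrite assignments_below in H; split.
        + apply assignments_below; intros z Hz Hzx; apply H; lia.
        + apply assignments_same; auto.
      - rewrite assignments_above in H; split.
        + apply assignments_above; intros z Hz Hzx; apply H; lia.
        + apply assignments_same; auto. }
    clear Hl; induction Hs as [|x l Hs IH Hd]; constructor.
    + apply IH; intros; apply Hord; simpl; auto.
    + destruct Hd; constructor; apply Hord; simpl; auto.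
Qed.

End Assignments.

(** * Equivalence of the two notions of validity *)

Lemma satisfies_of_holds (M : structure) v phi :
  (forall C : structure, (Finite M -> Finite C) -> holds C (equation phi)) ->
  satisfies M v phi.
Proof.
  (* The successor makes every variable of [phi] a valid position and [n] positive. *)
  intros H; set (n := S (list_max (vars phi))).
  assert (Hl : forall x, In x (vars phi) -> x < n).
  { intros x Hx; unfold n.
    pose proof (proj1 (list_max_le (vars phi) _) (le_n _)) as Hle.
    rewrite Forall_forall in Hle; specialize (Hle x Hx); lia. }
  assert (Hn : 0 < n) by (unfold n; lia).
  set (C := assignments M (v 0) n).
  assert (Hax : full C (axioms (vars phi))).
  { apply axioms_assignments; auto using sorted_vars. }
  set (s := of_fun M n v : C).
  apply (translate_correct C M (const M n) (vars phi) phi s s).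
  - apply base_model_assignments, Hn.
  - auto.
  - apply var_in_add_vars.
  - intros x Hx; apply assignments_value.
    unfold s; rewrite get_of_fun; auto.
  - apply holds_equation; auto. apply H, finite_tuple.
Qed.

Lemma holds_of_satisfies (C : structure) phi :
  (forall (M : structure) v, (Finite C -> Finite M) -> satisfies M v phi) ->
  holds C (equation phi).
Proof.
  intros H; apply holds_equation; intros Hax u w.
  destruct (base_model_exists C phi u Hax) as (M & b & v & Hfin & Hb & Hv).
  apply (translate_correct C M b (vars phi) phi u w v); auto.
  apply var_in_add_vars.
Qed.

(** Both transfer lemmas offer the implication between finiteness of the two structures; it is
    ignored here and used for finite validity. *)
Lemma equation_valid_iff phi : formula_valid phi <-> equation_valid (equation phi).
Proof.
  split.
  - intros H C; apply holds_of_satisfies; auto.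
  - intros H M v; apply satisfies_of_holds; auto.
Qed.

Lemma equation_finitely_valid_iff phi :
  formula_finitely_valid phi <-> equation_finitely_valid (equation phi).
Proof.
  split.
  - intros H C HC; apply holds_of_satisfies; auto.
  - intros H M HM v; apply satisfies_of_holds; auto.
Qed.

(** * Programming in the lambda-calculus *)

Local Notation "# n" := (LVar n) (at level 5, n at level 0, format "# n").
Local Notation "s ⋅ t" := (LApp s t) (at level 40, left associativity).
Local Notation "'λ' s" := (LLam s) (at level 45, right associativity).

Definition lvalue (s : lterm) : Prop := exists s', s = λ s'.

Lemma lvalue_lam s : lvalue (λ s).
Proof. exists s; reflexivity. Qed.

Lemma lbounded_weaken k k' s : lbounded k s -> k <= k' -> lbounded k' s.
Proof.
  revert k k'; induction s as [n|s IHs t IHt|s IHs]; simpl; intros k k' H Hk.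
  - lia.
  - destruct H; split; eauto.
  - apply (IHs (S k)); auto; lia.
Qed.

Lemma lbounded_closed k s : lclosed s -> lbounded k s.
Proof. intros H; apply (lbounded_weaken 0); auto; lia. Qed.

(** A boolean test, so that closedness of concrete programs is settled by computation. *)
Fixpoint lboundedb (k : nat) (s : lterm) : bool :=
  match s with
  | LVar n => n <? k
  | s ⋅ t => lboundedb k s && lboundedb k t
  | λ s => lboundedb (S k) s
  end.

Lemma lboundedb_bounded k s : lboundedb k s = true -> lbounded k s.
Proof.
  revert k; induction s as [n|s IHs t IHt|s IHs]; simpl; intros k H.
  - apply Nat.ltb_lt, H.
  - apply andb_prop in H as []; auto.
  - auto.
Qed.

Lemma lsubst_bounded k k' s u : lbounded k s -> k <= k' -> lsubst s k' u = s.
Proof.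
  revert k k'; induction s as [n|s IHs t IHt|s IHs]; simpl; intros k k' H Hk.
  - destruct (Nat.eqb_spec n k'); auto; lia.
  - destruct H; f_equal; eauto.
  - f_equal; apply (IHs (S k)); auto; lia.
Qed.

Lemma lsubst_closed s k u : lclosed s -> lsubst s k u = s.
Proof. intros H; apply (lsubst_bounded 0); auto; lia. Qed.

Lemma lsteps_beta s t : lvalue t -> lsteps ((λ s) ⋅ t) (lsubst s 0 t).
Proof. intros [t' ->]; apply rt_step, lstep_beta. Qed.

Lemma lsteps_trans s t u : lsteps s t -> lsteps t u -> lsteps s u.
Proof. apply rt_trans. Qed.

Lemma lsteps_appl s s' t : lsteps s s' -> lsteps (s ⋅ t) (s' ⋅ t).
Proof.
  induction 1; [apply rt_step, lstep_appl; auto|apply rt_refl|eapply rt_trans; eauto].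
Qed.

Lemma lsteps_appr s t t' : lsteps t t' -> lsteps (s ⋅ t) (s ⋅ t').
Proof.
  induction 1; [apply rt_step, lstep_appr; auto|apply rt_refl|eapply rt_trans; eauto].
Qed.

(* Automation for reduction sequences *)
Create HintDb lclosed.
Create HintDb lvalue.
Create HintDb lsteps.
#[local] Hint Extern 1 (lvalue _) => eexists; reflexivity : lvalue.
#[local] Hint Extern 1 (lclosed _) =>
  apply lboundedb_bounded; vm_compute; reflexivity : lclosed.

Ltac close_term :=
  unfold lclosed; cbn [lbounded];
  repeat match goal with |- _ /\ _ => split end;
  first [lia | solve [apply lbounded_closed; auto with lclosed]].

Ltac value_term := solve [auto with lvalue].

Ltac simplify_subst :=
  cbn [lsubst Nat.eqb]; repeat rewrite lsubst_closed by close_term.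

(** Registered specifications are tried first, so that a call to a known program counts as one step;
    then beta, then hypotheses such as the induction hypothesis, then the two sides of an
    application. *)
Ltac reduce :=
  first [ solve [eauto with lsteps nocore]
        | lazymatch goal with |- lsteps ((λ _) ⋅ _) _ => apply lsteps_beta; value_term end
        | match goal with H : _ |- _ => solve [apply H] end
        | apply lsteps_appl; reduce
        | apply lsteps_appr; reduce ].

Ltac step := eapply lsteps_trans; [reduce | simplify_subst].
Ltac steps := simplify_subst; repeat (first [apply rt_refl | step]).

(** * Recursion and Scott-encoded data *)

Definition self_apply : lterm := λ λ (#0 ⋅ (λ (#2 ⋅ #2 ⋅ #1 ⋅ #0))).

Definition rec (s : lterm) : lterm := λ (self_apply ⋅ self_apply ⋅ s ⋅ #0).

(** A call-by-value form of Turing's fixed-point combinator: the inner abstraction delays the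
    self-application, and after unfolding it is syntactically [rec s] again. *)
Lemma lsteps_rec p s u :
  p = rec s -> lclosed s -> lvalue s -> lvalue u -> lsteps (p ⋅ u) (s ⋅ p ⋅ u).
Proof.
  intros -> Hc Hs Hu; unfold rec.
  eapply rt_trans; [apply lsteps_beta, Hu|].
  cbn [lsubst Nat.eqb]; rewrite (lsubst_closed s) by auto.
  apply lsteps_appl.
  eapply rt_trans; [apply lsteps_appl, lsteps_beta, lvalue_lam|].
  eapply rt_trans; [apply lsteps_beta, Hs|].
  cbn; apply rt_refl.
Qed.

(** The [n] arguments are bound outside the [k] binders of the encoding, the first one outermost, so
    their indices run from [k + n - 1] down to [k]. *)
Definition constructor (k i n : nat) : lterm :=
  Nat.iter n LLam (scott k i (map LVar (rev (seq k n)))).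

Ltac close_encoding :=
  unfold lclosed; simpl;
  repeat match goal with |- _ /\ _ => split end;
  first [lia | solve [apply lbounded_closed; auto with lclosed]].

Lemma closed_nat n : lclosed (encode_nat n).
Proof. induction n; close_encoding. Qed.
#[local] Hint Resolve closed_nat : lclosed.

Lemma closed_formula phi : lclosed (encode_formula phi).
Proof. induction phi; close_encoding. Qed.
#[local] Hint Resolve closed_formula : lclosed.

Lemma closed_cor_term t : lclosed (encode_cor_term t).
Proof. induction t; close_encoding. Qed.
#[local] Hint Resolve closed_cor_term : lclosed.

Fixpoint encode_list (l : list nat) : lterm :=
  match l with
  | [] => scott 2 0 []
  | x :: l => scott 2 1 [encode_nat x; encode_list l]
  end.

Lemma closed_list l : lclosed (encode_list l).
Proof. induction l; close_encoding. Qed.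
#[local] Hint Resolve closed_list : lclosed.

Definition encode_comparison (c : comparison) : lterm :=
  match c with
  | Datatypes.Eq => scott 3 0 []
  | Lt => scott 3 1 []
  | Gt => scott 3 2 []
  end.

Lemma closed_comparison c : lclosed (encode_comparison c).
Proof. destruct c; close_encoding. Qed.
#[local] Hint Resolve closed_comparison : lclosed.

Lemma value_nat n : lvalue (encode_nat n).
Proof. destruct n; apply lvalue_lam. Qed.

Lemma value_formula phi : lvalue (encode_formula phi).
Proof. destruct phi; apply lvalue_lam. Qed.

Lemma value_cor_term t : lvalue (encode_cor_term t).
Proof. destruct t; apply lvalue_lam. Qed.

Lemma value_list l : lvalue (encode_list l).
Proof. destruct l; apply lvalue_lam. Qed.

Lemma value_comparison c : lvalue (encode_comparison c).
Proof. destruct c; apply lvalue_lam. Qed.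
#[local] Hint Resolve value_nat value_formula value_cor_term value_list
  value_comparison : lvalue.

Ltac construct := cbn; steps.

Lemma lsteps_succ n :
  lsteps (constructor 2 1 1 ⋅ encode_nat n) (encode_nat (S n)).
Proof. construct. Qed.

Lemma lsteps_cons x l :
  lsteps (constructor 2 1 2 ⋅ encode_nat x ⋅ encode_list l) (encode_list (x :: l)).
Proof. construct. Qed.

Lemma lsteps_sym a :
  lsteps (constructor 6 0 1 ⋅ encode_nat a) (encode_cor_term (Sym a)).
Proof. construct. Qed.

Lemma lsteps_compl t :
  lsteps (constructor 6 2 1 ⋅ encode_cor_term t) (encode_cor_term (Compl t)).
Proof. construct. Qed.

Lemma lsteps_inter t s :
  lsteps (constructor 6 3 2 ⋅ encode_cor_term t ⋅ encode_cor_term s)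
    (encode_cor_term (Inter t s)).
Proof. construct. Qed.

Lemma lsteps_comp t s :
  lsteps (constructor 6 4 2 ⋅ encode_cor_term t ⋅ encode_cor_term s)
    (encode_cor_term (Comp t s)).
Proof. construct. Qed.

Lemma lsteps_conv t :
  lsteps (constructor 6 5 1 ⋅ encode_cor_term t) (encode_cor_term (Conv t)).
Proof. construct. Qed.

Lemma lsteps_equation t s :
  lsteps (constructor 1 0 2 ⋅ encode_cor_term t ⋅ encode_cor_term s)
    (encode_cor_equation (CorEq t s)).
Proof. construct. Qed.

#[local] Hint Resolve lsteps_succ lsteps_cons lsteps_sym lsteps_compl lsteps_inter
  lsteps_comp lsteps_conv lsteps_equation : lsteps.

Ltac scott_case := intros; cbn; steps.

Lemma lsteps_case_zero s t :
  lclosed s -> lclosed t -> lvalue s -> lvalue t ->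
  lsteps (encode_nat 0 ⋅ s ⋅ t) s.
Proof. scott_case. Qed.

Lemma lsteps_case_succ n s t :
  lclosed s -> lclosed t -> lvalue s -> lvalue t ->
  lsteps (encode_nat (S n) ⋅ s ⋅ t) (t ⋅ encode_nat n).
Proof. scott_case. Qed.

Lemma lsteps_case_nil s t :
  lclosed s -> lclosed t -> lvalue s -> lvalue t ->
  lsteps (encode_list [] ⋅ s ⋅ t) s.
Proof. scott_case. Qed.

Lemma lsteps_case_cons x l s t :
  lclosed s -> lclosed t -> lvalue s -> lvalue t ->
  lsteps (encode_list (x :: l) ⋅ s ⋅ t) (t ⋅ encode_nat x ⋅ encode_list l).
Proof. scott_case. Qed.

Lemma lsteps_case_comparison c s t u :
  lclosed s -> lclosed t -> lclosed u -> lvalue s -> lvalue t -> lvalue u ->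
  lsteps (encode_comparison c ⋅ s ⋅ t ⋅ u)
    match c with Datatypes.Eq => s | Lt => t | Gt => u end.
Proof. destruct c; scott_case. Qed.

Lemma lsteps_case_formula phi s0 s1 s2 s3 s4 :
  lclosed s0 -> lclosed s1 -> lclosed s2 -> lclosed s3 -> lclosed s4 ->
  lvalue s0 -> lvalue s1 -> lvalue s2 -> lvalue s3 -> lvalue s4 ->
  lsteps (encode_formula phi ⋅ s0 ⋅ s1 ⋅ s2 ⋅ s3 ⋅ s4)
    match phi with
    | Rel a x y => s0 ⋅ encode_nat a ⋅ encode_nat x ⋅ encode_nat y
    | Eq x y => s1 ⋅ encode_nat x ⋅ encode_nat y
    | Not phi => s2 ⋅ encode_formula phi
    | And phi psi => s3 ⋅ encode_formula phi ⋅ encode_formula psi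
    | Ex x phi => s4 ⋅ encode_nat x ⋅ encode_formula phi
    end.
Proof. destruct phi; scott_case. Qed.

#[local] Hint Extern 1 (lsteps _ _) =>
  first [ apply lsteps_case_zero | apply lsteps_case_succ
        | apply lsteps_case_nil | apply lsteps_case_cons
        | apply lsteps_case_comparison | apply lsteps_case_formula ];
  first [close_term | value_term] : lsteps.

(** * Programs computing the translation *)

Definition l_quadruple : lterm := rec
  (λ λ (#0 ⋅ encode_nat 0
        ⋅ (λ (constructor 2 1 1 ⋅ (constructor 2 1 1 ⋅ (constructor 2 1 1 ⋅
                (constructor 2 1 1 ⋅ (#2 ⋅ #0)))))))).

Ltac apply_rec :=
  eapply lsteps_rec; [reflexivity | close_term | apply lvalue_lam | value_term].

(** A recursive program is unfolded once by hand; its recursive calls are then discharged by the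
    induction hypothesis. *)
Ltac unfold_rec :=
  eapply lsteps_trans; [first [apply_rec | apply lsteps_appl; apply_rec] |].

Lemma lsteps_quadruple n :
  lsteps (l_quadruple ⋅ encode_nat n) (encode_nat (4 * n)).
Proof.
  induction n as [|n IH]; unfold_rec; simplify_subst.
  - steps.
  - replace (4 * S n) with (S (S (S (S (4 * n))))) by lia. steps.
Qed.
#[local] Hint Resolve lsteps_quadruple : lsteps.

Local Notation l_succ := (constructor 2 1 1).
Local Notation l_cons := (constructor 2 1 2).
Local Notation l_sym := (constructor 6 0 1).
Local Notation l_compl := (constructor 6 2 1).
Local Notation l_inter := (constructor 6 3 2).
Local Notation l_comp := (constructor 6 4 2).
Local Notation l_conv := (constructor 6 5 1).
Local Notation l_cor_eq := (constructor 1 0 2).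

Definition l_value : lterm := λ (l_sym ⋅ (l_quadruple ⋅ #0)).
Definition l_below : lterm := λ (l_sym ⋅ (l_succ ⋅ (l_quadruple ⋅ #0))).
Definition l_above : lterm := λ (l_sym ⋅ (l_succ ⋅ (l_succ ⋅ (l_quadruple ⋅ #0)))).
Definition l_atom : lterm :=
  λ (l_sym ⋅ (l_succ ⋅ (l_succ ⋅ (l_succ ⋅ (l_quadruple ⋅ #0))))).

Lemma lsteps_value x : lsteps (l_value ⋅ encode_nat x) (encode_cor_term (value x)).
Proof. unfold l_value; steps. Qed.

Lemma lsteps_below x : lsteps (l_below ⋅ encode_nat x) (encode_cor_term (below x)).
Proof. unfold l_below; steps. Qed.

Lemma lsteps_above x : lsteps (l_above ⋅ encode_nat x) (encode_cor_term (above x)).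
Proof. unfold l_above; steps. Qed.

Lemma lsteps_atom a : lsteps (l_atom ⋅ encode_nat a) (encode_cor_term (atom a)).
Proof. unfold l_atom; steps. Qed.
#[local] Hint Resolve lsteps_value lsteps_below lsteps_above lsteps_atom : lsteps.

Definition l_same : lterm := λ (l_comp ⋅ (l_value ⋅ #0) ⋅ (l_conv ⋅ (l_value ⋅ #0))).
Definition l_others : lterm := λ (l_inter ⋅ (l_below ⋅ #0) ⋅ (l_above ⋅ #0)).
Definition l_test : lterm :=
  λ (l_comp ⋅ (l_inter ⋅ #0 ⋅ encode_cor_term Id) ⋅ encode_cor_term top).
Definition l_included : lterm := λ λ (l_compl ⋅ (l_inter ⋅ #1 ⋅ (l_compl ⋅ #0))).

Lemma lsteps_same x : lsteps (l_same ⋅ encode_nat x) (encode_cor_term (same x)).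
Proof. unfold l_same; steps. Qed.

Lemma lsteps_others x : lsteps (l_others ⋅ encode_nat x) (encode_cor_term (others x)).
Proof. unfold l_others; steps. Qed.

Lemma lsteps_test t :
  lsteps (l_test ⋅ encode_cor_term t) (encode_cor_term (test t)).
Proof. unfold l_test; steps. Qed.

Lemma lsteps_included t s :
  lsteps (l_included ⋅ encode_cor_term t ⋅ encode_cor_term s)
    (encode_cor_term (included t s)).
Proof. unfold l_included; steps. Qed.
#[local] Hint Resolve lsteps_same lsteps_others lsteps_test lsteps_included : lsteps.

Definition l_translate : lterm := rec
  (λ λ (#0
    ⋅ (λ λ λ (l_test ⋅ (l_comp ⋅ (l_value ⋅ #1) ⋅
                (l_comp ⋅ (l_atom ⋅ #2) ⋅ (l_conv ⋅ (l_value ⋅ #0))))))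
    ⋅ (λ λ (l_test ⋅ (l_comp ⋅ (l_value ⋅ #1) ⋅ (l_conv ⋅ (l_value ⋅ #0)))))
    ⋅ (λ (l_compl ⋅ (#2 ⋅ #0)))
    ⋅ (λ λ (l_inter ⋅ (#3 ⋅ #1) ⋅ (#3 ⋅ #0)))
    ⋅ (λ λ (l_comp ⋅ (l_others ⋅ #1) ⋅ (#3 ⋅ #0))))).

Lemma lsteps_translate phi :
  lsteps (l_translate ⋅ encode_formula phi) (encode_cor_term (translate phi)).
Proof. induction phi; unfold_rec; steps. Qed.
#[local] Hint Resolve lsteps_translate : lsteps.

Definition l_local_axioms : lterm :=
  λ (l_inter
     ⋅ (l_inter
        ⋅ (l_included ⋅ encode_cor_term Id ⋅ (l_same ⋅ #0))
        ⋅ (l_included ⋅ (l_comp ⋅ (l_conv ⋅ (l_value ⋅ #0)) ⋅ (l_value ⋅ #0))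
             ⋅ encode_cor_term Id))
     ⋅ (l_inter
        ⋅ (l_included ⋅ (l_value ⋅ #0) ⋅ encode_cor_term base)
        ⋅ (l_included ⋅ encode_cor_term base ⋅
             (l_comp ⋅ (l_others ⋅ #0) ⋅ (l_value ⋅ #0))))).

Definition l_order_axioms : lterm :=
  λ λ (l_inter
       ⋅ (l_included ⋅ (l_below ⋅ #0) ⋅ (l_inter ⋅ (l_below ⋅ #1) ⋅ (l_same ⋅ #1)))
       ⋅ (l_included ⋅ (l_above ⋅ #1) ⋅ (l_inter ⋅ (l_above ⋅ #0) ⋅ (l_same ⋅ #0)))).

Definition l_head_axioms : lterm :=
  λ λ (#0 ⋅ encode_cor_term top ⋅ (λ λ (l_order_axioms ⋅ #3 ⋅ #1))).

Definition l_axioms : lterm := rec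
  (λ λ (#0 ⋅ encode_cor_term top
        ⋅ (λ λ (l_inter ⋅ (l_inter ⋅ (l_local_axioms ⋅ #1) ⋅ (l_head_axioms ⋅ #1 ⋅ #0))
                  ⋅ (#3 ⋅ #0))))).

Lemma lsteps_local_axioms x :
  lsteps (l_local_axioms ⋅ encode_nat x) (encode_cor_term (local_axioms x)).
Proof. unfold l_local_axioms; steps. Qed.

Lemma lsteps_order_axioms x y :
  lsteps (l_order_axioms ⋅ encode_nat x ⋅ encode_nat y)
    (encode_cor_term (order_axioms x y)).
Proof. unfold l_order_axioms; steps. Qed.
#[local] Hint Resolve lsteps_local_axioms lsteps_order_axioms : lsteps.

Lemma lsteps_head_axioms x l :
  lsteps (l_head_axioms ⋅ encode_nat x ⋅ encode_list l)
    (encode_cor_term (head_axioms x l)).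
Proof. unfold l_head_axioms; destruct l; steps. Qed.
#[local] Hint Resolve lsteps_head_axioms : lsteps.

Lemma lsteps_axioms l :
  lsteps (l_axioms ⋅ encode_list l) (encode_cor_term (axioms l)).
Proof. induction l; unfold_rec; steps. Qed.
#[local] Hint Resolve lsteps_axioms : lsteps.

(** The zero branch of the outer case is not an abstraction; it is evaluated first, for either form
    of the first number, and always yields an encoded comparison, hence a value. *)
Definition l_compare : lterm := rec
  (λ λ λ (#1 ⋅ (#0 ⋅ encode_comparison Datatypes.Eq ⋅ (λ (encode_comparison Lt)))
          ⋅ (λ (#1 ⋅ encode_comparison Gt ⋅ (λ (#4 ⋅ #1 ⋅ #0)))))).

Lemma lsteps_compare n m :
  lsteps (l_compare ⋅ encode_nat n ⋅ encode_nat m)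
    (encode_comparison (Nat.compare n m)).
Proof. revert m; induction n; intros [|m]; unfold_rec; steps. Qed.
#[local] Hint Resolve lsteps_compare : lsteps.

(* A branch of a case must be a value, so the branches on the comparison are
   thunks; the argument [encode_nat 0] that forces them is arbitrary. *)
Definition l_insert : lterm := rec
  (λ λ λ (#0 ⋅ (l_cons ⋅ #1 ⋅ encode_list [])
          ⋅ (λ λ (l_compare ⋅ #3 ⋅ #1
                  ⋅ (λ #3) ⋅ (λ (l_cons ⋅ #4 ⋅ #3)) ⋅ (λ (l_cons ⋅ #2 ⋅ (#5 ⋅ #4 ⋅ #1)))
                  ⋅ encode_nat 0)))).

Lemma lsteps_insert x l :
  lsteps (l_insert ⋅ encode_nat x ⋅ encode_list l) (encode_list (insert x l)).
Proof.
  induction l as [|y l IH]; unfold_rec; steps.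
  (* The rest of the run depends on which thunk the comparison selects. *)
  simpl insert; destruct (Nat.compare x y); steps.
Qed.
#[local] Hint Resolve lsteps_insert : lsteps.

Definition l_add_vars : lterm := rec
  (λ λ λ (#1
    ⋅ (λ λ λ (l_insert ⋅ #1 ⋅ (l_insert ⋅ #0 ⋅ #3)))
    ⋅ (λ λ (l_insert ⋅ #1 ⋅ (l_insert ⋅ #0 ⋅ #2)))
    ⋅ (λ (#3 ⋅ #0 ⋅ #1))
    ⋅ (λ λ (#4 ⋅ #1 ⋅ (#4 ⋅ #0 ⋅ #2)))
    ⋅ (λ λ (l_insert ⋅ #1 ⋅ (#4 ⋅ #0 ⋅ #2))))).

Lemma lsteps_add_vars phi l :
  lsteps (l_add_vars ⋅ encode_formula phi ⋅ encode_list l)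
    (encode_list (add_vars phi l)).
Proof. revert l; induction phi; intros l; unfold_rec; steps. Qed.
#[local] Hint Resolve lsteps_add_vars : lsteps.

Definition l_equation : lterm :=
  λ (l_cor_eq
     ⋅ (l_inter
        ⋅ (l_compl ⋅ (l_comp ⋅ encode_cor_term top ⋅
             (l_comp ⋅ (l_compl ⋅ (l_axioms ⋅ (l_add_vars ⋅ #0 ⋅ encode_list [0])))
                ⋅ encode_cor_term top)))
        ⋅ (l_compl ⋅ (l_translate ⋅ #0)))
     ⋅ encode_cor_term empty).

Lemma computable_equation : computable equation.
Proof.
  exists l_equation; split.
  - close_term.
  - intros phi; unfold l_equation; steps.
Qed.

Theorem theorem1 :
  exists f : formula -> cor_equation,
    computable f /\
    (exists c d : nat, forall phi : formula,
       cor_equation_size (f phi) <= c * formula_size phi + d) /\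
    (forall phi : formula, formula_valid phi <-> equation_valid (f phi)) /\
    (forall phi : formula,
       formula_finitely_valid phi <-> equation_finitely_valid (f phi)).
Proof.
  exists equation; split; [exact computable_equation|split; [|split]].
  - exists 105, 200; exact equation_size.
  - exact equation_valid_iff.
  - exact equation_finitely_valid_iff.
Qed.
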